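(* Let $u,v\in S_n$, let $\mathbf{i}=(i_1,\ldots,i_m)$ be a double reduced word for $(u,v)$, and suppose an element $x\in L^{u,v}$ can be factored as $x=x_{i_1}(t_1)\cdots x_{i_m}(t_m)$ with all $t_k$ nonzero elements of the skew field $\mathcal F$. Then the factorization parameters $t_k$ ($k=1,\dots,m$) are determined by the following formula, where $y=\psi^{u,v}(x)$ and $i=|i_k|$: $$t_k=\begin{cases}\Delta^i_{v_{<k},u_{>k}}(y)^{-1}\,\Delta^i_{v_{<k},u_{\ge k}}(y)=\Delta^{i+1}_{v_{<k},u_{\ge k}}(y)^{-1}\,\Delta^{i+1}_{v_{<k},u_{>k}}(y) & \text{if } i_k<0,\\[2pt] \Delta^i_{v_{\le k},u_{>k}}(y)^{-1}\,\Delta^{i+1}_{v_{<k},u_{>k}}(y)=\Delta^i_{v_{<k},u_{>k}}(y)^{-1}\,\Delta^{i+1}_{v_{\le k},u_{>k}}(y) & \text{if } i_k>0.\end{cases}$$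
   Context: Let $\mathcal F$ be a skew field, $G=GL_n(\mathcal F)$, $[a,b]=\{a,a+1,\dots,b\}$ (empty if $a>b$). Quasideterminants: for a square matrix $A=(a_{ij})_{i\in I,j\in J}$, $|A|_{ij}=a_{ij}$ if $|I|=1$; otherwise, if $A^{ij}$ ($A$ with row $i$ and column $j$ deleted) is invertible, $|A|_{ij}=a_{ij}-r_i(A^{ij})^{-1}c_j$, where $r_i$ is row $i$ of $A$ without $a_{ij}$ and $c_j$ is column $j$ of $A$ without $a_{ij}$. Positive quasiminors: for $I,J\subset[1,n]$ with $|I|=|J|$, $i\in I$, $j\in J$, $\Delta^{i,j}_{I,J}(x)=(-1)^{d_i(I)+d_j(J)}|x_{I,J}|_{i,j}$, where $x_{I,J}$ is the submatrix with rows $I$ and columns $J$, and $d_i(I)$ (resp. $d_j(J)$) is the number of elements of $I$ greater than $i$ (resp. of $J$ greater than $j$). For $u,v\in S_n$ and $k\in[1,n]$, $\Delta^k_{u,v}:=\Delta^{u(k),v(k)}_{u[1,k],v[1,k]}$. Groups: $B$ (resp. $B^-$) is the group of upper (resp. lower) triangular matrices in $G$, $U$ the group of upper unitriangular matrices. Each $x\in B^-U$ is written uniquely as $x=[x]_-[x]_+$ with $[x]_-\in B^-$, $[x]_+\in U$. $S_n$ is embedded in $G$ as permutation matrices ($u e_k=e_{u(k)}$). Let $s_i=(i,i+1)$, let $\varphi_i:GL_2(\mathcal F)\to G$ be the embedding as the $2\times2$ block in rows and columns $i,i+1$, $\overline{s_i}=\varphi_i\begin{pmatrix}0&-1\\1&0\end{pmatrix}$,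 and for $w\in S_n$ let $\overline w=\overline{s_{j_1}}\cdots\overline{s_{j_l}}$ for any reduced word $w=s_{j_1}\cdots s_{j_l}$ (independent of the choice). The reduced double Bruhat cell is $L^{u,v}=U\overline uU\cap B^-vB^-$. Positive inverse: $x^\iota=J_nx^{-1}J_n$, $J_n=\mathrm{diag}(-1,1,-1,\dots,(-1)^n)$. Twist map: for $x\in L^{u,v}$, $\psi^{u,v}(x)=([x\,\overline{v^{-1}}]_-)^\iota\,(x^\iota)^{-1}\,([\overline u^{\,-1}x]_+)^\iota$. One-parameter elements: for $i\in[1,n-1]$, $t\in\mathcal F^\times$, $x_i(t)=\varphi_i\begin{pmatrix}1&t\\0&1\end{pmatrix}$, $x_{-i}(t)=\varphi_i\begin{pmatrix}t^{-1}&0\\1&t\end{pmatrix}$. A double reduced word for $(u,v)$ is a sequence $(i_1,\dots,i_m)$ in $\{\pm1,\dots,\pm(n-1)\}$, $m=\ell(u)+\ell(v)$, which is a shuffle of $(-j_1,\dots,-j_{\ell(u)})$ with $(j_1,\dots,j_{\ell(u)})$ a reduced word for $u$, and a reduced word for $v$ in $[1,n-1]$. With the convention $s_{-i}=1$ for $i\in[1,n-1]$, set $u_{\ge k}=s_{-i_m}s_{-i_{m-1}}\cdots s_{-i_k}$, $u_{>k}=s_{-i_m}\cdots s_{-i_{k+1}}$, $v_{\le k}=s_{i_1}\cdots s_{i_k}$, $v_{<k}=s_{i_1}\cdots s_{i_{k-1}}$. *)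

(* Defs.v *)
From mathcomp Require Import all_boot all_order all_fingroup all_algebra.
From mathcomp Require classical_sets.
Set Implicit Arguments.
Unset Strict Implicit.
Unset Printing Implicit Defensive.

Import GRing.Theory.
Local Open Scope ring_scope.

(* MathComp has no structure of skew fields: they are rendered as
   F : unitRingType (nontrivial, not assumed commutative) together with
   GRing.field_axiom F, i.e., every x != 0 is a unit.
   The size of the matrices is n.+1, so that GL_N is covered for all N >= 1.
   All indices are 0-based: k : 'I_n.+1 stands for k + 1 in [1, n + 1], and
   j : 'I_n for the simple reflection (j + 1, j + 2).                        *)

Section Matrices.
Variable F : unitRingType.

(* invmx and unitmx need commutative coefficients. *)
Definition is_inv_mx (p q : nat) (A : 'M[F]_(p, q)) (B : 'M[F]_(q, p)) : Prop :=
  A *m B = 1%:M /\ B *m A = 1%:M.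

Definition invertible_mx (p q : nat) (A : 'M[F]_(p, q)) : Prop :=
  exists B, is_inv_mx A B.

(* The two-sided inverse of A, and 0 if A is not invertible. *)
Definition inv_mx (p q : nat) (A : 'M[F]_(p, q)) : 'M[F]_(q, p) :=
  classical_sets.xget 0 (is_inv_mx A).

Variable n : nat.
Implicit Types (x : 'M[F]_n.+1) (I J : {set 'I_n.+1}) (i j : 'I_n.+1).

Definition submx_set x I J : 'M[F]_(#|I|, #|J|) :=
  \matrix_(a, b) x (enum_val a) (enum_val b).

(* The quasideterminant |x_{I,J}|_{i,j}. When #|I| = 1 the deleted matrix is
   the (invertible) empty matrix, and the correction term is 0. *)
Definition qdet_defined I J i j x : Prop :=
  invertible_mx (submx_set x (I :\ i) (J :\ j)).

Definition qdet I J i j x : F :=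
  x i j -
  ((\row_(b < #|J :\ j|) x i (enum_val b))
   *m inv_mx (submx_set x (I :\ i) (J :\ j))
   *m (\col_(a < #|I :\ i|) x (enum_val a) j)) 0 0.

Definition num_gt i I : nat := #|[set a in I | (i < a)%N]|.

Definition qminor I J i j x : F :=
  (-1) ^+ (num_gt i I + num_gt j J) * qdet I J i j x.

(* u[1, k], for a permutation u *)
Definition perm_init (u : 'S_n.+1) (k : 'I_n.+1) : {set 'I_n.+1} :=
  u @: [set a : 'I_n.+1 | (a <= k)%N].

(* Delta^k_{u,v}(x), and the condition for it to be defined *)
Definition Delta_defined (k : 'I_n.+1) (u v : 'S_n.+1) x : Prop :=
  qdet_defined (perm_init u k) (perm_init v k) (u k) (v k) x.

Definition Delta (k : 'I_n.+1) (u v : 'S_n.+1) x : F :=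
  qminor (perm_init u k) (perm_init v k) (u k) (v k) x.

End Matrices.

Section Words.
Variable n : nat.

(* The two indices on which the simple reflection with index i acts. *)
Definition lo (i : 'I_n) : 'I_n.+1 := widen_ord (leqnSn n) i.
Definition hi (i : 'I_n) : 'I_n.+1 := lift ord0 i.

Definition simple_refl (i : 'I_n) : 'S_n.+1 := tperm (lo i) (hi i).

(* s_{j_1} ... s_{j_l} as a composite of functions, rightmost factor first;
   since (s * t)%g is t \o s in MathComp, the word has to be reversed. *)
Definition word_perm (js : seq 'I_n) : 'S_n.+1 :=
  (\prod_(j <- rev js) simple_refl j)%g.

Definition reduced_word (w : 'S_n.+1) (js : seq 'I_n) : Prop :=
  word_perm js = w /\ forall js', word_perm js' = w -> (size js <= size js')%N.

(* A letter (true, j) stands for -(j + 1), and (false, j) for j + 1. *)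
Definition letter : Type := (bool * 'I_n)%type.

Definition neg_part (w : seq letter) : seq 'I_n := [seq a.2 | a <- w & a.1].
Definition pos_part (w : seq letter) : seq 'I_n := [seq a.2 | a <- w & ~~ a.1].

Definition double_reduced_word (u v : 'S_n.+1) (w : seq letter) : Prop :=
  reduced_word u (neg_part w) /\ reduced_word v (pos_part w).

(* The position k is 0-based, so that the prefix of indices < k is take k w
   and the suffix of indices >= k is drop k w. The convention s_{-i} = 1
   amounts to dropping the letters of the other sign. *)
Definition u_ge (w : seq letter) (k : nat) := word_perm (rev (neg_part (drop k w))).
Definition u_gt (w : seq letter) (k : nat) := u_ge w k.+1.
Definition v_lt (w : seq letter) (k : nat) := word_perm (pos_part (take k w)).
Definition v_le (w : seq letter) (k : nat) := v_lt w k.+1.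

End Words.

Section Cells.
Variables (F : unitRingType) (n : nat).
Notation M := 'M[F]_n.+1.

Definition mx22 (a b c d : F) : 'M[F]_2 :=
  \matrix_(i, j) if i == 0 then (if j == 0 then a else b)
                 else (if j == 0 then c else d).

(* The embedding of GL_2 as the block in rows and columns lo i, hi i *)
Definition phi (i : 'I_n) (A : 'M[F]_2) : M :=
  \matrix_(a, b)
    if (a \in [:: lo i; hi i]) && (b \in [:: lo i; hi i])
    then A (inord (a - i)%N) (inord (b - i)%N) else (a == b)%:R.

(* u e_k = e_{u k}; this is the transpose of perm_mx u. *)
Definition pmx (u : 'S_n.+1) : M := \matrix_(a, b) (a == u b)%:R.

Definition sbar (i : 'I_n) : M := phi i (mx22 0 (-1) 1 0).

(* The result does not depend on which reduced word of w is picked. *)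
Definition wbar (w : 'S_n.+1) : M :=
  \prod_(j <- classical_sets.xget [::] (reduced_word w)) sbar j.

Definition in_Bminus (x : M) : Prop := invertible_mx x /\ is_trig_mx x.

Definition in_U (x : M) : Prop := is_trig_mx x^T /\ forall i, x i i = 1.

Definition in_L (u v : 'S_n.+1) (x : M) : Prop :=
  (exists a b, [/\ in_U a, in_U b & x = a *m wbar u *m b]) /\
  (exists a b, [/\ in_Bminus a, in_Bminus b & x = a *m pmx v *m b]).

Definition is_BU_fact (x : M) (p : M * M) : Prop :=
  [/\ in_Bminus p.1, in_U p.2 & x = p.1 *m p.2].

(* [x]_- and [x]_+, for x in B^- U (arbitrarily 0 otherwise) *)
Definition BU_fact (x : M) : M * M := classical_sets.xget (0, 0) (is_BU_fact x).
Definition minus_part (x : M) : M := (BU_fact x).1.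
Definition plus_part (x : M) : M := (BU_fact x).2.

(* diag(-1, 1, -1, ...) *)
Definition Jmx : M := \matrix_(a, b) if a == b then (-1) ^+ a.+1 else 0.

Definition pos_inv (x : M) : M := Jmx *m inv_mx x *m Jmx.

Definition twist (u v : 'S_n.+1) (x : M) : M :=
  pos_inv (minus_part (x *m wbar (v^-1)%g))
  *m inv_mx (pos_inv x)
  *m pos_inv (plus_part (inv_mx (wbar u) *m x)).

(* x_i(t) for a letter i of either sign *)
Definition x_elt (i : letter n) (t : F) : M :=
  if i.1 then phi i.2 (mx22 t^-1 0 1 t) else phi i.2 (mx22 1 t 0 1).

End Cells.

(* Main.v *)
Require Import Defs.
From mathcomp Require Import all_boot all_order all_fingroup all_algebra.
From mathcomp Require Import zify.
From mathcomp Require classical_sets.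
Import GRing.Theory.
Local Open Scope ring_scope.

Set Implicit Arguments.
Unset Strict Implicit.
Unset Printing Implicit Defensive.

(* Write sbar, ubar, ... for the lifts of permutations, B for the inverse of
   [x vbar^-1]_- and K for the inverse of [ubar^-1 x]_+. Then the twist is
   y = J B x K J. Splitting x = x_{<k} x_{>=k} turns
     (v_{<k})bar^-1 y (u_{>=k})bar   into   J N_k R_k J,
   where N_k = (v_{<k}^-1)bar B x_{<k} and R_k = x_{>=k} K ((u_{>=k}^-1)bar)^-1.
   Building x one letter at a time (on the left for N, on the right for R)
   shows that N_k is always lower triangular and R_k upper unitriangular. So
   Delta^j_{v_{<k}, u_{>=k}}(y) is the j-th diagonal entry of N_k, and the
   recursion N_{k+1} = N_k x_{-i}(t) or N_{k+1} = sbar_i N_k x_i(t) reads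
   t_k off two such entries. *)

(** * Reduced words, the exchange condition and ascents *)

Section Words.
Variable n : nat.
Implicit Types (i j : 'I_n) (js : seq 'I_n) (p q : 'I_n.+1).

Lemma lohi_lt i : (lo i < hi i)%N.
Proof. by rewrite /lo /hi /= /bump. Qed.

Lemma lohi_neq i : lo i != hi i.
Proof. by rewrite -val_eqE neq_ltn lohi_lt. Qed.

Lemma hilo_eqF i : (hi i == lo i) = false.
Proof. by rewrite eq_sym (negPf (lohi_neq i)). Qed.

Variant index_spec i p : Prop :=
| IndexLo of p = lo i
| IndexHi of p = hi i
| IndexOther of p != lo i & p != hi i.

Lemma indexP i p : index_spec i p.
Proof.
case: (eqVneq p (lo i)) => [|h1]; first exact: IndexLo.
case: (eqVneq p (hi i)) => [|h2]; first exact: IndexHi.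
exact: IndexOther.
Qed.

Lemma word_perm_cons j js : word_perm (j :: js) = (word_perm js * simple_refl j)%g.
Proof. by rewrite /word_perm rev_cons -cats1 big_cat big_seq1. Qed.

Lemma word_perm_cat js1 js2 :
  word_perm (js1 ++ js2) = (word_perm js2 * word_perm js1)%g.
Proof. by rewrite /word_perm rev_cat big_cat. Qed.

Lemma word_perm_rcons js j : word_perm (rcons js j) = (simple_refl j * word_perm js)%g.
Proof. by rewrite -cats1 word_perm_cat /word_perm big_seq1. Qed.

Lemma word_perm_rev js : word_perm (rev js) = (word_perm js)^-1%g.
Proof.
elim: js => [|j js IH]; first by rewrite /word_perm big_nil invg1.
rewrite rev_cons word_perm_rcons word_perm_cons IH invMg.
by rewrite /simple_refl tpermV.
Qed.

Definition reduced js : Prop := reduced_word (word_perm js) js.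

(** A shorter word for the prefix, followed by [js2], would shorten the whole word. *)
Lemma reduced_catl js1 js2 : reduced (js1 ++ js2) -> reduced js1.
Proof.
case=> _ h; split=> // js' e; rewrite -(leq_add2r (size js2)) -!size_cat.
by apply: h; rewrite !word_perm_cat e.
Qed.

Lemma reduced_catr js1 js2 : reduced (js1 ++ js2) -> reduced js2.
Proof.
case=> _ h; split=> // js' e; rewrite -(leq_add2l (size js1)) -!size_cat.
by apply: h; rewrite !word_perm_cat e.
Qed.

Lemma reduced_rev js : reduced js -> reduced (rev js).
Proof.
case=> _ h; split=> // js' e; rewrite size_rev -(size_rev js'); apply: h.
by rewrite word_perm_rev e word_perm_rev invgK.
Qed.

(** No index lies strictly between [lo j] and [hi j], so every comparison involving a third index
    survives the swap. *)
Lemma simple_refl_flip j p q :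
  (p < q)%N -> (simple_refl j q < simple_refl j p)%N -> p = lo j /\ q = hi j.
Proof.
rewrite /simple_refl; case: (indexP j p) => [->|->|p1 p2];
  case: (indexP j q) => [->|->|q1 q2]; rewrite ?tpermL ?tpermR //;
  rewrite ?tpermD 1?eq_sym //; move=> lt1 lt2; split=> //; exfalso;
  move: lt1 lt2; try move: p1 p2; try move: q1 q2;
  rewrite -?val_eqE /= /bump /=; lia.
Qed.

(* Exchange condition: the letter of js whose reflection puts the images of
   lo i and hi i in the wrong order can be deleted. *)
Lemma exchange_reduces js i :
  (word_perm js (hi i) < word_perm js (lo i))%N ->
  exists js', (size js').+1 = size js /\
    word_perm js' = (simple_refl i * word_perm js)%g.
Proof.
elim: js => [|j js IH]; first by rewrite /word_perm big_nil !perm1 ltnNge ltnW ?lohi_lt.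
rewrite word_perm_cons !permM => h.
case: (ltngtP (word_perm js (hi i)) (word_perm js (lo i))) => [/IH[js' [e1 e2]]|lt|].
- by exists (j :: js'); rewrite /= e1 word_perm_cons e2 mulgA.
- have [elo ehi] := simple_refl_flip lt h.
  exists js; split=> //; rewrite mulgA.
  (* Conjugating [simple_refl i] by [word_perm js] gives the swap of the images of [lo i] and
     [hi i]; these are [lo j] and [hi j], so the letter [j] cancels. *)
  have -> : (simple_refl i * word_perm js = word_perm js * simple_refl j)%g.
    by rewrite /simple_refl -elo -ehi -tpermJ conjgE !mulgA mulgV mul1g.
  by rewrite -mulgA /simple_refl tperm2 mulg1.
- by move/val_inj/perm_inj/eqP; rewrite eq_sym (negPf (lohi_neq i)).
Qed.

(** In the opposite order, the exchange condition would spell the permutation of [rcons js i] with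
    two letters fewer. This is the form in which reducedness enters the matrix computations. *)
Lemma reduced_ascent js i :
  reduced (rcons js i) -> (word_perm js (lo i) < word_perm js (hi i))%N.
Proof.
case=> _ red; case: ltngtP => //.
- case/exchange_reduces=> js' [sz e].
  by have := red js'; rewrite word_perm_rcons e size_rcons -sz ltnNge leqW // => /(_ erefl).
- by move/val_inj/perm_inj/eqP; rewrite (negPf (lohi_neq i)).
Qed.

End Words.

(** * Triangular matrices over a skew field *)

Section Triangular.
Variables (F : unitRingType) (n : nat).
Implicit Types (M N A B : 'M[F]_n.+1) (p q : 'I_n.+1) (r : 'I_n.+1 -> nat).

(* Triangularity with respect to a rank function: lower triangular matrices
   for lo_rk, upper triangular matrices for up_rk. *)
Definition rtrig r M : Prop := forall p q, (r p < r q)%N -> M p q = 0.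
Definition unitri r M : Prop := rtrig r M /\ forall p, M p p = 1.
Definition lo_rk p : nat := p.
Definition up_rk p : nat := (n - p)%N.

Lemma lo_rk_inj : injective lo_rk.
Proof. exact: val_inj. Qed.

Lemma up_rk_lt p q : (up_rk p < up_rk q)%N = (q < p)%N.
Proof. by rewrite /up_rk; have := ltn_ord p; have := ltn_ord q; lia. Qed.

Lemma up_rk_inj : injective up_rk.
Proof.
move=> p q; rewrite /up_rk => e; apply/val_inj => /=.
by have := ltn_ord p; have := ltn_ord q; lia.
Qed.

Lemma mulmx_entry M N p q : (M * N) p q = \sum_c M p c * N c q.
Proof. exact: mxE. Qed.

Lemma mx1_entry p q : (1 : 'M[F]_n.+1) p q = (p == q)%:R.
Proof. exact: mxE. Qed.

Lemma rtrig1 r : rtrig r 1.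
Proof. by move=> p q lt; rewrite mx1_entry; case: eqP lt => // ->; rewrite ltnn. Qed.

Lemma rtrigM r M N : rtrig r M -> rtrig r N -> rtrig r (M * N).
Proof.
move=> hM hN p q lt; rewrite mulmx_entry big1 // => c _.
case: (ltnP (r p) (r c)) => [/hM->|le]; first by rewrite mul0r.
by rewrite (hN c q) ?mulr0 // (leq_ltn_trans le).
Qed.

Lemma rtrigM_diag r M N p : injective r -> rtrig r M -> rtrig r N ->
  (M * N) p p = M p p * N p p.
Proof.
move=> r_inj hM hN; rewrite mulmx_entry (bigD1 p) //= big1 ?addr0 // => c ne.
case: (ltngtP (r p) (r c)) => [/hM->|/hN->|/r_inj e]; rewrite ?mul0r ?mulr0 //.
by rewrite e eqxx in ne.
Qed.

Lemma unitri1 r : unitri r 1.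
Proof. by split=> [|p]; [apply: rtrig1 | rewrite mx1_entry eqxx]. Qed.

Lemma unitriM r M N : injective r -> unitri r M -> unitri r N -> unitri r (M * N).
Proof.
move=> r_inj [hM dM] [hN dN]; split; first exact: rtrigM.
by move=> p; rewrite (rtrigM_diag _ r_inj) // dM dN mulr1.
Qed.

(** The ring form of [is_inv_mx]. Keeping the inverse as an explicit witness lets inverses of long
    products be assembled by [mx_invM]. *)
Definition mx_inv M N : Prop := M * N = 1 /\ N * M = 1.

Lemma mx_inv1 : mx_inv 1 1.
Proof. by split; rewrite mulr1. Qed.

Lemma mx_invC M N : mx_inv M N -> mx_inv N M.
Proof. by case. Qed.

Lemma mx_invM M M' N N' : mx_inv M M' -> mx_inv N N' -> mx_inv (M * N) (N' * M').
Proof.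
move=> [e1 e2] [e3 e4]; split.
- by rewrite mulrA -(mulrA M) e3 mulr1.
- by rewrite mulrA -(mulrA N') e2 mulr1.
Qed.

Lemma mx_inv_uniq M N N' : mx_inv M N -> mx_inv M N' -> N = N'.
Proof. by move=> [_ e1] [e2 _]; rewrite -[N]mulr1 -e2 mulrA e1 mul1r. Qed.

Lemma inv_mxE M N : mx_inv M N -> inv_mx M = N.
Proof.
move=> h; rewrite /inv_mx; case: classical_sets.xgetP => [N' _ h'|/(_ N)].
- exact: (@mx_inv_uniq M).
- by case.
Qed.

Hypothesis fld : GRing.field_axiom F.

(** Forward substitution by rank: in row [p] of [M * N = 1], terms of higher rank vanish in [M] and
    those of lower rank vanish in [N] by induction. What remains is [E]; at [q = p] it makes the
    diagonal entry nonzero, and elsewhere it kills [N p q]. *)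
Lemma rtrig_inv r M N : injective r -> rtrig r M -> M * N = 1 ->
  rtrig r N /\ forall p, M p p != 0.
Proof.
move=> r_inj hM e.
have H k p : (r p < k)%N -> M p p != 0 /\ forall q, (r p < r q)%N -> N p q = 0.
  elim: k p => [|k IH] p //; rewrite ltnS => lek.
  have E q : (r p <= r q)%N -> M p p * N p q = (p == q)%:R.
    move=> le; rewrite -mx1_entry -e mulmx_entry (bigD1 p) //= big1 ?addr0 // => c ne.
    case: (ltngtP (r p) (r c)) => [/hM->|lt|/r_inj ec]; first by rewrite mul0r.
    - have [_ ->] := IH c (leq_trans lt lek); first by rewrite mulr0.
      exact: leq_trans lt le.
    - by rewrite ec eqxx in ne.
  have nz : M p p != 0.
    apply/eqP=> z; have := E p (leqnn _).
    by rewrite z mul0r eqxx => /eqP; rewrite eq_sym oner_eq0.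
  split=> // q lt; have := E q (ltnW lt).
  have -> : (p == q) = false by case: eqP lt => // ->; rewrite ltnn.
  by move/(congr1 (fun z => (M p p)^-1 * z)); rewrite mulrA mulVr ?mul1r ?mulr0 // fld.
by split=> [p|p]; have [] := H _ p (ltnSn (r p)).
Qed.

Lemma unitri_inv r M N : injective r -> unitri r M -> M * N = 1 -> unitri r N.
Proof.
move=> r_inj [hM dM] e; have [hN _] := rtrig_inv r_inj hM e; split=> // p.
have := rtrigM_diag p r_inj hM hN.
by rewrite e mx1_entry eqxx dM mul1r => <-.
Qed.

Lemma lo_up_eq1 M : rtrig lo_rk M -> unitri up_rk M -> M = 1.
Proof.
move=> hL [hU d]; apply/matrixP=> p q; rewrite mx1_entry.
case: (ltngtP p q) => [lt|lt|/val_inj->]; last by rewrite d eqxx.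
- by rewrite hL //; case: eqP lt => // ->; rewrite ltnn.
- by rewrite hU ?up_rk_lt //; case: eqP lt => // ->; rewrite ltnn.
Qed.

Lemma in_UP M : in_U M <-> unitri up_rk M.
Proof.
split=> [[/is_trig_mxP h d]|[h d]]; split=> //.
- by move=> p q; rewrite up_rk_lt => /h; rewrite mxE.
- by apply/is_trig_mxP=> p q lt; rewrite mxE h // up_rk_lt.
Qed.

Lemma in_BminusP M : in_Bminus M <-> (exists N, mx_inv M N) /\ rtrig lo_rk M.
Proof.
by split=> [[h /is_trig_mxP t]|[h t]]; split=> //; apply/is_trig_mxP.
Qed.

(** Uniqueness of the Gauss factorization: the quotient of two lower factors equals the quotient of
    the unitriangular ones, so it is both lower triangular and upper unitriangular, hence 1. The
    arbitrary choice in [BU_fact] is thereby determined. *)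
Lemma BU_factE X M M' P P' : mx_inv M M' -> mx_inv P P' ->
  rtrig lo_rk M -> unitri up_rk P -> X = M * P -> BU_fact X = (M, P).
Proof.
move=> iM iP hM hP ->; rewrite /BU_fact.
case: classical_sets.xgetP => [q _ [/in_BminusP [[q1' iq] h1] /in_UP h2 e]|/(_ (M, P))];
  last first.
  by case; split; [apply/in_BminusP; split=> //; exists M' | apply/in_UP |].
have [hq1' _] := rtrig_inv lo_rk_inj h1 iq.1.
have hP' := unitri_inv up_rk_inj hP iP.1.
have E : q1' * M = q.2 * P'.
  by rewrite -[M]mulr1 -iP.1 [M * _]mulrA [M * P]e !mulrA [q1' * q.1]iq.2 mul1r.
have E1 : q1' * M = 1.
  apply: lo_up_eq1; first exact: rtrigM.
  by rewrite E; apply: unitriM => //; apply: up_rk_inj.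
have e1 : q.1 = M by rewrite -[LHS]mulr1 -E1 mulrA iq.1 mul1r.
have e2 : q.2 = P by rewrite -[LHS]mulr1 -iP.2 mulrA -E E1 mul1r.
by rewrite (surjective_pairing q) e1 e2.
Qed.

End Triangular.

(** * Two-by-two blocks and signed permutation matrices *)

Section Blocks.
Variables (F : unitRingType) (n : nat).
Implicit Types (M N : 'M[F]_n.+1) (i : 'I_n) (p q : 'I_n.+1) (a b c d : F)
  (r : 'I_n.+1 -> nat).

(** Replaces the [inord] arithmetic of [phi] by comparisons with [lo i] and [hi i]. *)
Lemma phiE i a b c d p q : phi i (mx22 a b c d) p q =
  if p == lo i then if q == lo i then a else if q == hi i then b else 0
  else if p == hi i then if q == lo i then c else if q == hi i then d else 0
  else (p == q)%:R.
Proof.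
have hl := hilo_eqF i.
have o0 : inord (lo i - i)%N = 0 :> 'I_2 by rewrite /= subnn; apply/val_inj; rewrite /= inordK.
have o1 : inord (hi i - i)%N = 1 :> 'I_2.
  by rewrite /= /bump /= subSnn; apply/val_inj; rewrite /= inordK.
rewrite mxE !inE; case: (indexP i p) => [->|->|/negPf p1 /negPf p2];
  case: (indexP i q) => [->|->|/negPf q1 /negPf q2];
  rewrite ?p1 ?p2 ?q1 ?q2 ?hl ?eqxx ?orbT /= ?o0 ?o1 ?mxE ?eqxx //=.
- by rewrite eq_sym q1.
- by rewrite eq_sym q2.
Qed.

Lemma phi_mull_lo i a b c d M q :
  (phi i (mx22 a b c d) * M) (lo i) q = a * M (lo i) q + b * M (hi i) q.
Proof.
rewrite mulmx_entry (bigD1 (lo i)) //= (bigD1 (hi i)) /=; last first.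
  by rewrite eq_sym lohi_neq.
rewrite big1 ?addr0 => [|e /andP[/negPf e1 /negPf e2]].
  by rewrite !phiE !eqxx eq_sym (negPf (lohi_neq i)).
by rewrite phiE eqxx e1 e2 mul0r.
Qed.

Lemma phi_mull_hi i a b c d M q :
  (phi i (mx22 a b c d) * M) (hi i) q = c * M (lo i) q + d * M (hi i) q.
Proof.
rewrite mulmx_entry (bigD1 (lo i)) //= (bigD1 (hi i)) /=; last first.
  by rewrite eq_sym lohi_neq.
rewrite big1 ?addr0 => [|e /andP[/negPf e1 /negPf e2]].
  by rewrite !phiE !eqxx eq_sym (negPf (lohi_neq i)).
by rewrite phiE eqxx [hi i == _]eq_sym (negPf (lohi_neq i)) e1 e2 mul0r.
Qed.

Lemma phi_mull_other i a b c d M p q : p != lo i -> p != hi i ->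
  (phi i (mx22 a b c d) * M) p q = M p q.
Proof.
move=> /negPf p1 /negPf p2; rewrite mulmx_entry (bigD1 p) //= big1 ?addr0 => [|e ne].
  by rewrite phiE p1 p2 eqxx mul1r.
by rewrite phiE p1 p2 eq_sym (negPf ne) mul0r.
Qed.

Lemma phi_mulr_lo i a b c d M p :
  (M * phi i (mx22 a b c d)) p (lo i) = M p (lo i) * a + M p (hi i) * c.
Proof.
have hl := hilo_eqF i.
rewrite mulmx_entry (bigD1 (lo i)) //= (bigD1 (hi i)) /=; last by rewrite hl.
rewrite big1 ?addr0 => [|e /andP[/negPf e1 /negPf e2]].
  by rewrite !phiE !eqxx hl.
by rewrite phiE e1 e2 mulr0.
Qed.

Lemma phi_mulr_hi i a b c d M p :
  (M * phi i (mx22 a b c d)) p (hi i) = M p (lo i) * b + M p (hi i) * d.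
Proof.
have hl := hilo_eqF i.
rewrite mulmx_entry (bigD1 (lo i)) //= (bigD1 (hi i)) /=; last by rewrite hl.
rewrite big1 ?addr0 => [|e /andP[/negPf e1 /negPf e2]].
  by rewrite !phiE !eqxx hl.
by rewrite phiE e1 e2 mulr0.
Qed.

Lemma phi_mulr_other i a b c d M p q : q != lo i -> q != hi i ->
  (M * phi i (mx22 a b c d)) p q = M p q.
Proof.
move=> /negPf q1 /negPf q2; rewrite mulmx_entry (bigD1 q) //= big1 ?addr0 => [|e ne].
  by rewrite phiE q1 q2 eqxx mulr1.
by rewrite phiE q1 q2 (negPf ne) !if_same mulr0.
Qed.

Lemma phiM i a b c d a' b' c' d' :
  phi i (mx22 a b c d) * phi i (mx22 a' b' c' d') =
  phi i (mx22 (a * a' + b * c') (a * b' + b * d') (c * a' + d * c') (c * b' + d * d')).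
Proof.
have hl := hilo_eqF i.
apply/matrixP=> p q; rewrite [RHS]phiE.
case: (indexP i p) => [->|->|p1 p2]; rewrite ?eqxx ?hl.
- rewrite phi_mull_lo !phiE !eqxx hl.
  by case: ifP => // _; case: ifP => // _; rewrite !mulr0 addr0.
- rewrite phi_mull_hi !phiE !eqxx hl.
  by case: ifP => // _; case: ifP => // _; rewrite !mulr0 addr0.
- by rewrite phi_mull_other // phiE (negPf p1) (negPf p2).
Qed.

Lemma phi1 i : phi i (mx22 1 0 0 1) = 1 :> 'M[F]_n.+1.
Proof.
have hl := hilo_eqF i.
apply/matrixP=> p q; rewrite phiE mx1_entry.
case: (indexP i p) => [->|->|/negPf-> /negPf->] //; rewrite ?eqxx ?hl ![_ == q]eq_sym.
- by case: eqP => // _; rewrite if_same.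
- by case: (eqVneq q (lo i)) => [->|_]; [rewrite eq_sym hl | case: ifP].
Qed.

Definition sbarV i : 'M[F]_n.+1 := phi i (mx22 0 1 (-1) 0).

Lemma sbar_inv i : mx_inv (sbar F i) (sbarV i).
Proof.
by split; rewrite /sbar /sbarV phiM;
  rewrite !(mulr0, mul0r, mulr1, mul1r, addr0, add0r, mulrN, mulNr, opprK, oppr0) phi1.
Qed.

(* Multiplying by 2x2 blocks preserves triangularity up to the entries of
   the block itself, as lo i and hi i have adjacent ranks. *)
Definition adjacent_rk r i := forall e, e != lo i -> e != hi i ->
  (r e < r (lo i))%N = (r e < r (hi i))%N /\ (r (lo i) < r e)%N = (r (hi i) < r e)%N.

Lemma lo_rk_adj i : adjacent_rk (@lo_rk n) i.
Proof.
move=> e; rewrite -!val_eqE /lo_rk /= /bump /= => e1 e2.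
by split; apply/idP/idP; lia.
Qed.

Lemma up_rk_adj i : adjacent_rk (@up_rk n) i.
Proof. by move=> e e1 e2; rewrite !up_rk_lt; case: (lo_rk_adj e1 e2). Qed.

Lemma rtrig_phi r i M a b c d a' b' c' d' (Z := phi i (mx22 a b c d) * M *
    phi i (mx22 a' b' c' d')) :
  adjacent_rk r i -> rtrig r M ->
  ((r (lo i) < r (hi i))%N -> Z (lo i) (hi i) = 0) ->
  ((r (hi i) < r (lo i))%N -> Z (hi i) (lo i) = 0) ->
  rtrig r Z.
Proof.
move=> adj hM z1 z2 p q.
case: (indexP i p) => [->|->|p1 p2]; case: (indexP i q) => [->|->|q1 q2] lt;
  try by rewrite ltnn in lt.
- exact: z1.
- rewrite /Z phi_mulr_other // phi_mull_lo !hM ?mulr0 ?addr0 //.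
  by have [_ <-] := adj q q1 q2.
- exact: z2.
- rewrite /Z phi_mulr_other // phi_mull_hi !hM ?mulr0 ?addr0 //.
  by have [_ ->] := adj q q1 q2.
- rewrite /Z phi_mulr_lo !phi_mull_other // !hM ?mul0r ?addr0 //.
  by have [<- _] := adj p p1 p2.
- rewrite /Z phi_mulr_hi !phi_mull_other // !hM ?mul0r ?addr0 //.
  by have [-> _] := adj p p1 p2.
- by rewrite /Z phi_mulr_other // phi_mull_other // hM.
Qed.

Lemma rtrig_lo_phi i M a b c d a' b' c' d' (Z := phi i (mx22 a b c d) * M *
    phi i (mx22 a' b' c' d')) :
  rtrig (@lo_rk n) M -> Z (lo i) (hi i) = 0 -> rtrig (@lo_rk n) Z.
Proof.
move=> hM z; apply: rtrig_phi => //; first exact: lo_rk_adj.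
by rewrite /lo_rk ltnNge ltnW // lohi_lt.
Qed.

Lemma unitri_up_phi i M a b c d a' b' c' d' (Z := phi i (mx22 a b c d) * M *
    phi i (mx22 a' b' c' d')) :
  unitri (@up_rk n) M -> Z (hi i) (lo i) = 0 -> Z (lo i) (lo i) = 1 ->
  Z (hi i) (hi i) = 1 -> unitri (@up_rk n) Z.
Proof.
move=> [hM dM] z d1 d2; split.
  apply: rtrig_phi => //; first exact: up_rk_adj.
  by rewrite up_rk_lt ltnNge ltnW // lohi_lt.
move=> p; case: (indexP i p) => [->|->|p1 p2] //.
by rewrite /Z phi_mulr_other // phi_mull_other.
Qed.

(* sgn w q is the nonzero entry of wbar w in column q; it is also the sign that
   Delta attaches to the row (or column) w q. *)
Definition sgn (w : 'S_n.+1) p : F := (-1) ^+ num_gt (w p) (perm_init w p).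
Definition spmx (w : 'S_n.+1) : 'M[F]_n.+1 := \matrix_(p, q) (sgn w q *+ (p == w q)).

(** Pulled back along [w], the count becomes the number of inversions of [w] whose later position is
    [p]. *)
Lemma num_gtE (w : 'S_n.+1) p :
  num_gt (w p) (perm_init w p) = (\sum_(q : 'I_n.+1) ((q <= p) && (w p < w q)))%N.
Proof.
rewrite /num_gt -sum1_card big_mkcond (reindex_inj (@perm_inj _ w)) /=.
apply: eq_bigr => q _; rewrite inE /perm_init mem_imset ?inE; last exact: perm_inj.
by case: andP.
Qed.

Lemma sgn_sqr w p : sgn w p * sgn w p = 1.
Proof. by rewrite -expr2 sqrr_sign. Qed.

Lemma spmx_mull w M p q : (spmx w * M) (w p) q = sgn w p * M p q.
Proof.
rewrite mulmx_entry (bigD1 p) //= big1 ?addr0 => [|e ne]; rewrite mxE ?eqxx //.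
by rewrite (inj_eq perm_inj) eq_sym (negPf ne) mul0r.
Qed.

Lemma spmx_mulr w M p q : (M * spmx w) p q = M p (w q) * sgn w q.
Proof.
rewrite mulmx_entry (bigD1 (w q)) //= big1 ?addr0 => [|e ne]; rewrite mxE ?eqxx //.
by rewrite (negPf ne) mulr0.
Qed.

Lemma spmx_entry w1 w2 M N p q : N * spmx w2 = spmx w1 * M ->
  N (w1 p) (w2 q) = sgn w1 p * M p q * sgn w2 q.
Proof.
move=> e; rewrite -(spmx_mull w1) -e spmx_mulr.
by rewrite -mulrA sgn_sqr mulr1.
Qed.

Lemma spmx1 : spmx 1 = 1.
Proof.
apply/matrixP=> p q; rewrite mxE mx1_entry /sgn num_gtE perm1 big1 => [|c _].
  by rewrite expr0.
by rewrite !perm1; case: leqP => //= le; rewrite ltnNge le.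
Qed.

(** At an ascent the swap creates exactly one inversion, between the values now at [lo i] and
    [hi i]. It is counted at the later position, so only the sign of column [hi i] changes, which is
    the -1 in [sbar]. Any other position has [lo i] and [hi i] on the same side, so its count is
    unchanged. *)
Lemma spmx_sbar (w : 'S_n.+1) i : (w (lo i) < w (hi i))%N ->
  spmx w * sbar F i = spmx (simple_refl i * w)%g.
Proof.
move=> lt; have hl := hilo_eqF i.
have E p : num_gt ((simple_refl i * w)%g p) (perm_init (simple_refl i * w)%g p) =
    (\sum_(q : 'I_n.+1) ((simple_refl i q <= p) && (w (simple_refl i p) < w q)))%N.
  rewrite num_gtE (reindex_inj (@perm_inj _ (simple_refl i))) /=.
  apply: eq_bigr => q _; rewrite !permM.
  by rewrite {2}/simple_refl tpermK.
have E1 q : q != lo i -> q != hi i -> sgn (simple_refl i * w)%g q = sgn w q.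
  move=> q1 q2; rewrite /sgn E num_gtE; congr (_ ^+ _); apply: eq_bigr => e _.
  rewrite /simple_refl [tperm _ _ q]tpermD 1?eq_sym //; congr (nat_of_bool (_ && _)).
  move: q1 q2; case: tpermP => [->|->|//]; rewrite -?val_eqE /= /bump /=; lia.
have E2 : sgn (simple_refl i * w)%g (lo i) = sgn w (hi i).
  rewrite /sgn E num_gtE; congr (_ ^+ _); apply: eq_bigr => e _.
  rewrite /simple_refl tpermL; case: tpermP => [->|->|].
  - by rewrite [(w (hi i) < _)%N]ltnNge (ltnW lt) !andbF.
  - by rewrite ltnn !andbF.
  - move=> /eqP e1 /eqP e2; congr (nat_of_bool (_ && _)).
    by move: e1 e2; rewrite -?val_eqE /= /bump /=; lia.
have E3 : sgn (simple_refl i * w)%g (hi i) = - sgn w (lo i).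
  rewrite /sgn E num_gtE (bigD1 (hi i)) //= [in RHS](bigD1 (hi i)) //=.
  rewrite /simple_refl tpermR ltnW ?lohi_lt // lt leqNgt lohi_lt add0n exprS mulN1r.
  congr (- (_ ^+ _)); apply: eq_bigr => e /negPf ne.
  case: tpermP => [->|e2|].
  - by rewrite ltnn !andbF.
  - by rewrite e2 eqxx in ne.
  - move=> /eqP e1 /eqP e2; congr (nat_of_bool (_ && _)).
    by move: e1 e2; rewrite -?val_eqE /= /bump /=; lia.
apply/matrixP=> p q; rewrite [RHS]mxE permM.
case: (indexP i q) => [->|->|q1 q2].
- by rewrite phi_mulr_lo mulr0 mulr1 add0r mxE E2 /simple_refl tpermL.
- by rewrite phi_mulr_hi mulr0 addr0 mulrN1 mxE E3 /simple_refl tpermR mulNrn.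
- by rewrite phi_mulr_other // mxE E1 // /simple_refl tpermD // eq_sym.
Qed.

Definition sword (js : seq 'I_n) : 'M[F]_n.+1 := \prod_(j <- js) sbar F j.
Definition swordV (js : seq 'I_n) : 'M[F]_n.+1 := \prod_(j <- rev js) sbarV j.

Lemma sword_rcons js i : sword (rcons js i) = sword js * sbar F i.
Proof. by rewrite /sword -cats1 big_cat big_seq1. Qed.

Lemma sword_cons i js : sword (i :: js) = sbar F i * sword js.
Proof. by rewrite /sword big_cons. Qed.

Lemma swordV_rcons js i : swordV (rcons js i) = sbarV i * swordV js.
Proof. by rewrite /swordV rev_rcons big_cons. Qed.

Lemma sword_inv js : mx_inv (sword js) (swordV js).
Proof.
elim/last_ind: js => [|js i IH]; first by rewrite /sword /swordV !big_nil; exact: mx_inv1.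
by rewrite sword_rcons swordV_rcons; apply: mx_invM => //; exact: sbar_inv.
Qed.

(** Every letter of a reduced word is an ascent for the word before it, so [spmx_sbar] applies
    throughout. The result depends only on the permutation; hence [wbar] may be computed from any
    reduced word. *)
Lemma swordE js : reduced js -> sword js = spmx (word_perm js).
Proof.
elim/last_ind: js => [|js i IH] red; first by rewrite /sword /word_perm !big_nil spmx1.
rewrite sword_rcons IH; last by apply: (@reduced_catl _ js [:: i]); rewrite cats1.
by rewrite spmx_sbar ?word_perm_rcons //; apply: reduced_ascent.
Qed.

Lemma wbarE w js : reduced_word w js -> wbar F w = sword js.
Proof.
move=> h; rewrite /wbar; case: classical_sets.xgetP => [js' _ h'|/(_ js)]; last by case.
have [e r] := h; have [e' r'] := h'.
by rewrite -/(sword js') !swordE ?e ?e' // /reduced ?e ?e'.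
Qed.

(** Conjugation moves entry [(p, q)] to [(w p, w q)] up to sign, and the signs cancel on the
    diagonal. This serves to carry elementary factors past a lift. *)
Lemma unitri_conj r js (E : 'M[F]_n.+1) : reduced js -> (forall p, E p p = 1) ->
  (forall p q, (r (word_perm js p) < r (word_perm js q))%N -> E p q = 0) ->
  unitri r (sword js * E * swordV js).
Proof.
move=> red d h; set w := word_perm js in h *.
have H p q : (sword js * E * swordV js) (w p) (w q) = sgn w p * E p q * sgn w q.
  by apply: spmx_entry; rewrite -/w -swordE // -mulrA (sword_inv js).2 mulr1.
split=> [p q|p].
  by rewrite -[p](permKV w) -[q](permKV w) => lt; rewrite H h // mulr0 mul0r.
by rewrite -[p](permKV w) H d mulr1 sgn_sqr.
Qed.

(** The reverse transport: triangularity after conjugation forces zeros before it. *)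
Lemma entry_conj r js (P : 'M[F]_n.+1) p q : reduced js ->
  rtrig r (sword js * P * swordV js) ->
  (r (word_perm js p) < r (word_perm js q))%N -> P p q = 0.
Proof.
move=> red h lt; set w := word_perm js in lt.
have := h _ _ lt; rewrite (@spmx_entry w w P); last first.
  by rewrite -swordE // -mulrA (sword_inv js).2 mulr1.
move/(congr1 (fun z => sgn w p * z * sgn w q)).
by rewrite mulr0 mul0r -!mulrA sgn_sqr mulr1 mulrA sgn_sqr mul1r.
Qed.

End Blocks.

(** * Quasiminors from a Gauss decomposition *)

Section Minors.
Variables (F : unitRingType) (n : nat).
Hypothesis fld : GRing.field_axiom F.
Implicit Types (M X R Y : 'M[F]_n.+1) (p q k l : 'I_n.+1).

Lemma perm_init_del (w : 'S_n.+1) k :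
  perm_init w k :\ w k = w @: [set p : 'I_n.+1 | (p < k)%N].
Proof.
apply/setP=> e; rewrite -[e](permKV w) !inE /perm_init !mem_imset ?inE; try exact: perm_inj.
by rewrite (inj_eq perm_inj) -val_eqE /= ltn_neqAle.
Qed.

Lemma sum_perm_init (w : 'S_n.+1) k (f : 'I_n.+1 -> F) :
  \sum_(c < #|perm_init w k :\ w k|) f (enum_val c) = \sum_(q : 'I_n.+1 | (q < k)%N) f (w q).
Proof.
rewrite -(big_enum_val f) /=.
rewrite perm_init_del big_imset /=; last by move=> ? ? _ _; exact: perm_inj.
by apply: eq_bigl => q; rewrite inE.
Qed.

Lemma perm_init_delP (w : 'S_n.+1) k e : e \in perm_init w k :\ w k ->
  exists2 p : 'I_n.+1, (p < k)%N & e = w p.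
Proof. by rewrite perm_init_del => /imsetP[p]; rewrite inE; exists p. Qed.

Lemma sum_init_full k (f : 'I_n.+1 -> F) :
  (forall q, (k <= q)%N -> f q = 0) -> \sum_(q : 'I_n.+1 | (q < k)%N) f q = \sum_q f q.
Proof.
move=> h; rewrite [RHS](bigID (fun q : 'I_n.+1 => (q < k)%N)) /=.
by rewrite [X in _ + X]big1 ?addr0 // => q; rewrite -leqNgt => /h.
Qed.

Lemma sgn_comm (w : 'S_n.+1) p (a : F) : sgn F w p * a = a * sgn F w p.
Proof. by rewrite -commr_sign. Qed.

Lemma sgnK (w : 'S_n.+1) p (a : F) : a * sgn F w p * sgn F w p = a.
Proof. by rewrite -mulrA sgn_sqr mulr1. Qed.

Lemma sgn_delta (w : 'S_n.+1) p q :
  sgn F w p * (p == q)%:R * sgn F w q = (p == q)%:R.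
Proof. by case: eqP => [->|_]; rewrite ?mulr0 ?mul0r // mulr1 sgn_sqr. Qed.

Lemma sum_init_split k (f : 'I_n.+1 -> F) : (forall q, (k < q)%N -> f q = 0) ->
  \sum_q f q = \sum_(q : 'I_n.+1 | (q < k)%N) f q + f k.
Proof.
move=> h; rewrite (bigD1 k) //= addrC; congr (_ + _).
rewrite (bigID (fun q : 'I_n.+1 => (q < k)%N)) /= [X in _ + X]big1 ?addr0.
  by apply: eq_bigl => q; rewrite -val_eqE /= neq_ltn; case: ltngtP.
move=> q /andP[ne]; rewrite -leqNgt => le; apply: h.
by rewrite ltn_neqAle le eq_sym ne.
Qed.

(* Here X * R is the Gauss decomposition of spmx a ^-1 * Y * spmx b. As in the
   commutative case, the leading blocks of X * R factor as the product of those
   of X and R; so the leading block of R' * X' inverts the deleted minor. *)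
Lemma DeltaE k (a b : 'S_n.+1) Y X X' R R' :
  mx_inv X X' -> mx_inv R R' -> rtrig (@lo_rk n) X -> unitri (@up_rk n) R ->
  Y * spmx F b = spmx F a * (X * R) ->
  Delta_defined k a b Y /\ Delta k a b Y = X k k.
Proof.
move=> iX iR hX hR e; set M := X * R in e.
have [hX' _] := rtrig_inv fld (@lo_rk_inj n) hX iX.1.
have [hR' dR'] := unitri_inv fld (@up_rk_inj n) hR iR.1.
have EY p q : Y (a p) (b q) = sgn F a p * M p q * sgn F b q by apply: spmx_entry.
have EX : M * R' = X by rewrite /M -mulrA iR.1 mulr1.
have ER : X' * M = R by rewrite /M mulrA iX.2 mul1r.
(* Column [l < k] of [R'] and row [l < k] of [X'] vanish from index [k] on, so the truncated sums
   already give the entries of [X] and [R]. *)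
have sumX p l : (l < k)%N -> \sum_(q : 'I_n.+1 | (q < k)%N) M p q * R' q l = X p l.
  move=> lt; rewrite sum_init_full -?EX ?mulmx_entry // => q le.
  by rewrite hR' ?mulr0 // up_rk_lt (leq_trans lt).
have sumR l q : (l < k)%N -> \sum_(p : 'I_n.+1 | (p < k)%N) X' l p * M p q = R l q.
  move=> lt; rewrite sum_init_full -?ER ?mulmx_entry // => p le.
  by rewrite hX' ?mul0r // /lo_rk (leq_trans lt).
have z0 p q : (k < q)%N -> M p q * R' q k = 0.
  by move=> lt; rewrite hR' ?mulr0 // up_rk_lt.
(* The truncation at [l < k] matters: [h] is the product of the leading blocks of [R'] and [X'], and
   this is what inverts the leading block of [M]. *)
pose h q p := \sum_(l : 'I_n.+1 | (l < k)%N) R' q l * X' l p.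
have hl p p' : (p < k)%N -> \sum_(q : 'I_n.+1 | (q < k)%N) M p q * h q p' = (p == p')%:R.
  move=> lt; under eq_bigr do rewrite mulr_sumr; rewrite exchange_big /=.
  transitivity (\sum_(l : 'I_n.+1 | (l < k)%N) X p l * X' l p').
    apply: eq_bigr => l ltl; rewrite -(sumX p l ltl) mulr_suml.
    by apply: eq_bigr => q _; rewrite mulrA.
  rewrite sum_init_full -?mulmx_entry ?iX.1 ?mx1_entry // => l le.
  by rewrite hX ?mul0r // /lo_rk (leq_trans lt).
have hr q q' : (q' < k)%N -> \sum_(p : 'I_n.+1 | (p < k)%N) h q p * M p q' = (q == q')%:R.
  move=> lt; under eq_bigr do rewrite mulr_suml; rewrite exchange_big /=.
  transitivity (\sum_(l : 'I_n.+1 | (l < k)%N) R' q l * R l q').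
    apply: eq_bigr => l ltl; rewrite -(sumR l q' ltl) mulr_sumr.
    by apply: eq_bigr => p _; rewrite mulrA.
  rewrite sum_init_full -?mulmx_entry ?iR.2 ?mx1_entry // => l le.
  by rewrite hR.1 ?mulr0 // up_rk_lt (leq_trans lt).
set I := perm_init a k :\ a k; set J := perm_init b k :\ b k.
(* The signs of [EY] are put back, so that [g] inverts the minor of [Y] instead of that of [M]. *)
pose g q p := sgn F b q * h q p * sgn F a p.
pose W : 'M[F]_(#|J|, #|I|) :=
  \matrix_(c, r) g ((b^-1)%g (enum_val c)) ((a^-1)%g (enum_val r)).
set Z := submx_set Y I J.
have iW : is_inv_mx Z W.
  split; apply/matrixP=> r r'; rewrite !mxE.
  - under eq_bigr do rewrite !mxE.
    rewrite (sum_perm_init b k (fun z => Y (enum_val r) z *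
      g ((b^-1)%g z) ((a^-1)%g (enum_val r')))).
    rewrite -(inj_eq enum_val_inj).
    have [p ltp ->] := perm_init_delP (enum_valP r).
    have [p' ltp' ->] := perm_init_delP (enum_valP r').
    rewrite (inj_eq perm_inj) -(sgn_delta a) -(hl p p' ltp) mulr_sumr mulr_suml.
    by apply: eq_bigr => q _; rewrite !permK EY /g !mulrA sgnK.
  - under eq_bigr do rewrite !mxE.
    rewrite (sum_perm_init a k (fun z => g ((b^-1)%g (enum_val r)) ((a^-1)%g z) *
      Y z (enum_val r'))).
    rewrite -(inj_eq enum_val_inj).
    have [q ltq ->] := perm_init_delP (enum_valP r).
    have [q' ltq' ->] := perm_init_delP (enum_valP r').
    rewrite (inj_eq perm_inj) -(sgn_delta b) -(hr q q' ltq') mulr_sumr mulr_suml.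
    by apply: eq_bigr => p _; rewrite !permK EY /g !mulrA sgnK.
have def : Delta_defined k a b Y by exists W.
split=> //; rewrite /Delta /qminor /qdet -/I -/J.
have -> : inv_mx (submx_set Y I J) = W.
  rewrite /inv_mx; case: classical_sets.xgetP => [W' _ [_ e1]|/(_ W)]; last by case.
  by rewrite -[W']mulmx1 -iW.1 mulmxA e1 mul1mx.
(* Solves the linear system of the quasideterminant: for [p < k], [X p k = 0] expresses [M p k]
   through the earlier columns with coefficients [- R' q k], as [R' k k = 1]. *)
pose z q := - (sgn F b q * R' q k * sgn F b k).
have -> : \col_(r < #|I|) Y (enum_val r) (b k) =
    Z *m \col_(c < #|J|) z ((b^-1)%g (enum_val c)).
  apply/matrixP=> r o; rewrite !mxE; under eq_bigr do rewrite !mxE.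
  rewrite (sum_perm_init b k (fun e => Y (enum_val r) e * z ((b^-1)%g e))).
  have [p ltp ->] := perm_init_delP (enum_valP r).
  have := hX p k ltp; rewrite -EX mulmx_entry (sum_init_split (@z0 p)) => /eqP.
  rewrite addr_eq0 dR' mulr1 => /eqP sM.
  rewrite EY -[M p k]opprK -sM mulrN mulNr mulr_sumr mulr_suml -sumrN.
  by apply: eq_bigr => q _; rewrite permK EY /z mulrN !mulrA sgnK.
rewrite -mulmxA [W *m (Z *m _)]mulmxA iW.2 mul1mx mxE.
under eq_bigr do rewrite !mxE.
rewrite (sum_perm_init b k (fun e => Y (a k) e * z ((b^-1)%g e))) EY.
have -> : \sum_(q : 'I_n.+1 | (q < k)%N) Y (a k) (b q) * z ((b^-1)%g (b q)) =
    - (sgn F a k * (X k k - M k k) * sgn F b k).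
  have -> : X k k - M k k = \sum_(q : 'I_n.+1 | (q < k)%N) M k q * R' q k.
    by rewrite -EX mulmx_entry (sum_init_split (@z0 k)) dR' mulr1 addrK.
  rewrite mulr_sumr mulr_suml -sumrN.
  by apply: eq_bigr => q _; rewrite permK EY /z mulrN !mulrA sgnK.
(* The corner entry and the correction add up to [X k k] between two signs, which cancel those of
   [qminor]. *)
rewrite opprK -mulrDl -mulrDr addrC subrK exprD -/(sgn F a k) -/(sgn F b k).
by rewrite !mulrA (sgn_comm a k (sgn F b k)) sgnK (sgn_comm b) sgnK.
Qed.

(** * Conjugation by the alternating diagonal matrix *)

Lemma Jmx_mull M p q : (Jmx F n * M) p q = (-1) ^+ p.+1 * M p q.
Proof.
rewrite mulmx_entry (bigD1 p) //= big1 ?addr0 => [|e ne]; rewrite mxE ?eqxx //.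
by rewrite eq_sym (negPf ne) mul0r.
Qed.

Lemma Jmx_mulr M p q : (M * Jmx F n) p q = M p q * (-1) ^+ q.+1.
Proof.
rewrite mulmx_entry (bigD1 q) //= big1 ?addr0 => [|e ne]; rewrite mxE ?eqxx //.
by rewrite (negPf ne) mulr0.
Qed.

Lemma Jmx_sqr : Jmx F n * Jmx F n = 1.
Proof.
apply/matrixP=> p q; rewrite Jmx_mull mxE mx1_entry.
by case: eqP => // _; rewrite ?mulr0 // -expr2 sqrr_sign.
Qed.

Lemma Jmx_conj_diag M p : (Jmx F n * M * Jmx F n) p p = M p p.
Proof. by rewrite Jmx_mulr Jmx_mull -commr_sign -mulrA -expr2 sqrr_sign mulr1. Qed.

Lemma Jmx_conj_rtrig r M : rtrig r M -> rtrig r (Jmx F n * M * Jmx F n).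
Proof. by move=> h p q lt; rewrite Jmx_mulr Jmx_mull h // mulr0 mul0r. Qed.

Lemma Jmx_conj_unitri r M : unitri r M -> unitri r (Jmx F n * M * Jmx F n).
Proof.
move=> [h d]; split; first exact: Jmx_conj_rtrig.
by move=> p; rewrite Jmx_conj_diag.
Qed.

Lemma Jmx_inv : mx_inv (Jmx F n) (Jmx F n).
Proof. by split; rewrite Jmx_sqr. Qed.

(** The indices [lo i] and [hi i] carry opposite signs in [Jmx], so conjugation negates the
    off-diagonal entries of the block, which inverts [sbar]. *)
Lemma Jmx_sbar i : Jmx F n * sbar F i = sbarV F i * Jmx F n.
Proof.
apply/matrixP=> p q; rewrite Jmx_mulr Jmx_mull !phiE.
have hl := hilo_eqF i.
case: (indexP i p) => [->|->|/negPf-> /negPf->];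
  case: (indexP i q) => [->|->|/negPf q1 /negPf q2];
  rewrite ?eqxx ?hl ?q1 ?q2 ?mulr0 ?mul0r //.
- by rewrite mul1r mulrN1 [hi i : nat]/= /bump /= add1n [in RHS]exprS mulN1r.
- by rewrite mulN1r mulr1 [hi i : nat]/= /bump /= add1n [in LHS]exprS mulN1r.
all: by case: eqP => [->|_]; rewrite ?mulr0 ?mul0r // mul1r mulr1.
Qed.

(** Inverting each letter while keeping the order gives the inverse of the lift of the reversed
    word. *)
Lemma Jmx_sword js : Jmx F n * sword F js = swordV F (rev js) * Jmx F n.
Proof.
elim: js => [|j js IH]; first by rewrite /sword /swordV !big_nil mulr1 mul1r.
by rewrite sword_cons rev_cons swordV_rcons mulrA Jmx_sbar -mulrA IH mulrA.
Qed.

End Minors.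

(** * Building the two triangular factors letter by letter *)

Section Factorization.
Variables (F : unitRingType) (n : nat).
Hypothesis fld : GRing.field_axiom F.
Implicit Types (s : bool) (i : 'I_n) (t : F) (ws : seq (letter n * F)).

Notation lower := (rtrig (@lo_rk n)).
Notation upper1 := (unitri (@up_rk n)).

(** Letters are paired with their parameters, so that the word and the product are cut at the same
    place. *)
Definition x_word ws : 'M[F]_n.+1 := \prod_(a <- ws) x_elt a.1 a.2.
Definition pos ws := pos_part (unzip1 ws).
Definition neg ws := neg_part (unzip1 ws).
Definition nonzero ws := all (fun a => a.2 != 0) ws.

Definition x_eltV (a : letter n) t : 'M[F]_n.+1 :=
  if a.1 then phi a.2 (mx22 t 0 (-1) t^-1) else phi a.2 (mx22 1 (- t) 0 1).

Lemma x_elt_inv a t : t != 0 -> mx_inv (x_elt a t) (x_eltV a t).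
Proof.
move=> nz; have u := fld nz; case: a => [[] i]; rewrite /x_elt /x_eltV /=; split;
  by rewrite phiM !(mulr0, mul0r, mulr1, mul1r, mulrN1, mulN1r, addr0, add0r, divrr u,
    mulVr u, subrr, addNr) phi1.
Qed.

Lemma x_wordM ws1 ws2 : x_word (ws1 ++ ws2) = x_word ws1 * x_word ws2.
Proof. by rewrite /x_word big_cat. Qed.

Lemma x_word_cons a ws : x_word (a :: ws) = x_elt a.1 a.2 * x_word ws.
Proof. by rewrite /x_word big_cons. Qed.

Lemma x_word_rcons ws a : x_word (rcons ws a) = x_word ws * x_elt a.1 a.2.
Proof. by rewrite -cats1 x_wordM /x_word big_seq1. Qed.

Lemma x_word_inv ws : nonzero ws -> exists M, mx_inv (x_word ws) M.
Proof.
elim: ws => [|a ws IH] /=; first by exists 1; rewrite /x_word big_nil; exact: mx_inv1.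
by case/andP=> /(x_elt_inv a.1) h /IH[M hM]; exists (M * x_eltV a.1 a.2);
  rewrite x_word_cons; apply: mx_invM.
Qed.

Lemma nonzero_rcons ws a : nonzero (rcons ws a) = (a.2 != 0) && nonzero ws.
Proof. exact: all_rcons. Qed.

Lemma neg_rcons ws (s : bool) i t :
  neg (rcons ws ((s, i), t)) = if s then rcons (neg ws) i else neg ws.
Proof.
rewrite /neg /neg_part /unzip1 map_rcons filter_rcons /=.
by case: s => //=; rewrite map_rcons.
Qed.

Lemma lower_phi i (a c d : F) : lower (phi i (mx22 a 0 c d)).
Proof.
rewrite -[phi _ _]mulr1 -(phi1 F i) -[phi i (mx22 a 0 c d)]mulr1.
apply: rtrig_lo_phi; first exact: rtrig1.
by rewrite phi1 !mulr1 phiE eqxx eq_sym (negPf (lohi_neq i)) eqxx.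
Qed.

Lemma upper_x_elt_pos i t : upper1 (x_elt (false, i) t).
Proof.
have hl := hilo_eqF i.
have -> : x_elt (false, i) t = phi i (mx22 1 t 0 1) * 1 * phi i (mx22 1 0 0 1).
  by rewrite phi1 !mulr1.
by apply: unitri_up_phi; rewrite ?phi1 ?mulr1 ?phiE ?eqxx ?hl //; exact: unitri1.
Qed.

(** Covers parameters that may be zero, such as the correction [f] of [left_factor]. *)
Lemma x_elt_pos_inv i t : mx_inv (x_elt (false, i) t) (x_eltV (false, i) t).
Proof.
by split; rewrite /x_elt /x_eltV /= phiM
  !(mulr0, mul0r, mulr1, mul1r, addr0, add0r, subrr, addNr) phi1.
Qed.

Lemma pos_cat ws1 ws2 : pos (ws1 ++ ws2) = pos ws1 ++ pos ws2.
Proof. by rewrite /pos /pos_part /unzip1 map_cat filter_cat map_cat. Qed.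

Lemma neg_cat ws1 ws2 : neg (ws1 ++ ws2) = neg ws1 ++ neg ws2.
Proof. by rewrite /neg /neg_part /unzip1 map_cat filter_cat map_cat. Qed.

Lemma sbar_conj_upper i (f : F) :
  sbar F i * phi i (mx22 1 f 0 1) * sbarV F i = phi i (mx22 1 0 (- f) 1).
Proof.
by rewrite !phiM !(mulr0, mul0r, mulr1, mul1r, mulrN1, mulN1r, addr0, add0r, opprK, oppr0).
Qed.

Lemma sbar_conj_lower i (g : F) :
  sbar F i * phi i (mx22 1 0 g 1) * sbarV F i = phi i (mx22 1 (- g) 0 1).
Proof.
by rewrite !phiM !(mulr0, mul0r, mulr1, mul1r, mulrN1, mulN1r, addr0, add0r, opprK, oppr0).
Qed.

Lemma phi_unip_diag i (b c : F) p : phi i (mx22 1 b c 1) p p = 1.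
Proof. by rewrite phiE eqxx; case: eqP => // _; case: eqP. Qed.

(* The factor B is the inverse of [x vbar^-1]_-, where x = x_word ws. *)
Lemma left_factor ws : nonzero ws -> reduced (pos ws) ->
  exists B, [/\ exists A, mx_inv A B, lower B,
    upper1 (B * x_word ws * sword F (rev (pos ws))) &
    forall ws1 ws2, ws = ws1 ++ ws2 -> lower (sword F (rev (pos ws1)) * B * x_word ws1)].
Proof.
elim: ws => [_ _|[[s i] t] ws IH /= /andP[nz nzw] red].
  exists 1; rewrite /x_word /sword !big_nil !mulr1; split; [|exact: rtrig1|exact: unitri1|].
    by exists 1; exact: mx_inv1.
  by case=> [|? ?] // ws2 _; rewrite !big_nil !mulr1; exact: rtrig1.
have ixi := x_elt_inv (s, i) nz.
case: s red ixi => red ixi.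
(* A negative letter is lower triangular and leaves the positive word alone, so [B] simply absorbs
   its inverse. *)
- have [B [[A iA] hB hP hN]] := IH nzw red.
  have iA1 : mx_inv (x_elt (true, i) t * A) (B * x_eltV (true, i) t) by exact: mx_invM.
  have hA1 : lower (B * x_eltV (true, i) t).
    apply: rtrigM => //.
    by have [] := rtrig_inv fld (@lo_rk_inj n) (@lower_phi i _ _ _) ixi.1.
  exists (B * x_eltV (true, i) t); split => //.
  + by exists (x_elt (true, i) t * A).
  + by rewrite x_word_cons /= -!mulrA [x_eltV _ _ * _]mulrA ixi.2 mul1r mulrA.
  + case=> [|a ws1] ws2 /=; first by rewrite /sword /x_word !big_nil mul1r mulr1.
    case=> <- e; rewrite x_word_cons /= !mulrA -[_ * x_eltV _ _ * _]mulrA ixi.2 mulr1.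
    exact: hN e.
have red' : reduced (pos ws) by apply: (@reduced_catr _ [:: i]).
have [B [[A iA] hB hP hN]] := IH nzw red'.
set l := lo i; set h := hi i.
have [_ nzB] := rtrig_inv fld (@lo_rk_inj n) hB iA.2.
(* f (and g in right_factor) is chosen to kill the entry of the new B (resp. K) in the
   block of i that would break triangularity. *)
pose f := (B h l - B h h * t^-1) * (B l l)^-1.
set B1 := x_elt (false, i) f * sbarV F i * B * x_eltV (false, i) t.
have iB1 := mx_invM (mx_invM (mx_invM (x_elt_pos_inv i f) (mx_invC (sbar_inv F i)))
  (mx_invC iA)) (mx_invC ixi).
have hB1 : lower B1.
  rewrite /B1 /x_elt /sbarV phiM; apply: rtrig_lo_phi => //.
  rewrite phi_mulr_hi !phi_mull_lo !(mulr0, mul0r, mulr1, mul1r, addr0, add0r, mulrN1).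
  rewrite -/l -/h (hB l h (lohi_lt i)) mulr0 add0r mulNr /f.
  rewrite -[_ * _^-1 * _]mulrA mulVr ?fld // mulr1 opprB addrNK mulrN -mulrA mulVr ?fld //.
  by rewrite mulr1 addNr.
exists B1; split => //.
- by eexists; exact: mx_invC iB1.
- rewrite x_word_cons /= /pos /= rev_cons sword_rcons -/(pos ws).
  set P := B * _ * _ in hP.
  have -> : B1 * (x_elt (false, i) t * x_word ws) * (sword F (rev (pos ws)) * sbar F i) =
      x_elt (false, i) f * (sbarV F i * P * sbar F i).
    rewrite /B1 /P -!mulrA; congr (_ * (_ * (_ * _))).
    by rewrite !mulrA ixi.2 mul1r.
  apply: unitriM; [exact: up_rk_inj | exact: upper_x_elt_pos |].
  (* Conjugating [P] by the lift gives the matrix of the last clause for the whole word, which is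
     lower triangular; since [i] is an ascent, entry [(l, h)] lands above its diagonal. *)
  have P0 : P l h = 0.
    have red_rev : reduced (rcons (rev (pos ws)) i).
      by rewrite -rev_cons; apply: reduced_rev.
    apply: (@entry_conj _ _ (@lo_rk n) (rev (pos ws))).
    + by apply: reduced_rev.
    + rewrite /P !mulrA -[_ * sword _ _ * swordV _ _]mulrA (sword_inv F _).1 mulr1.
      by apply: (hN ws [::]); rewrite cats0.
    + exact: reduced_ascent.
  apply: unitri_up_phi => //; rewrite ?phi_mulr_lo ?phi_mulr_hi ?phi_mull_lo ?phi_mull_hi;
    rewrite !(mulr0, mul0r, mulr1, mul1r, addr0, add0r, mulrN1, mulN1r, mulNr, opprK).
  + by rewrite -/l -/h P0 oppr0.
  + exact: hP.2.
  + exact: hP.2.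
- case=> [|a ws1] ws2 /=; first by rewrite /sword /x_word !big_nil mul1r mulr1.
  case=> <- e; rewrite x_word_cons /= /pos /= rev_cons sword_rcons -/(pos ws1).
  have red1 : reduced (i :: pos ws1).
    by apply: (@reduced_catl _ _ (pos ws2)); rewrite cat_cons -pos_cat -e.
  have := @reduced_ascent _ (rev (pos ws1)) i.
  rewrite -rev_cons => /(_ (reduced_rev red1)) asc.
  (* The new matrix is the old one for [ws1], multiplied on the left by a conjugated elementary
     matrix. Its off-diagonal entry starts at [(h, l)], and the ascent keeps it below the
     diagonal. *)
  have -> : sword F (rev (pos ws1)) * sbar F i * B1 * (x_elt (false, i) t * x_word ws1) =
      sword F (rev (pos ws1)) * (sbar F i * x_elt (false, i) f * sbarV F i) *
      swordV F (rev (pos ws1)) * (sword F (rev (pos ws1)) * B * x_word ws1).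
    rewrite /B1 -!mulrA; do 4 congr (_ * _).
    by rewrite ![x_eltV _ _ * _]mulrA ![swordV _ _ * _]mulrA ixi.2 (sword_inv F _).2 !mul1r.
  apply: rtrigM; last exact: hN e.
  apply: proj1; apply: unitri_conj.
  + by apply: reduced_rev; apply: (@reduced_catr _ [:: i]).
  + by move=> p; rewrite sbar_conj_upper phi_unip_diag.
  + move=> p q lt; rewrite sbar_conj_upper phiE.
    case: (eqVneq p l) lt => [->|_]; last case: (eqVneq p h) => [->|_].
    * case: (eqVneq q l) => [->|_]; [by rewrite ltnn | by rewrite if_same].
    * case: (eqVneq q l) => [->|_]; first by rewrite ltnNge ltnW.
      by case: (eqVneq q h) => [->|]; first by rewrite ltnn.
    * by case: (eqVneq p q) => [->|]; first by rewrite ltnn.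
Qed.

(* The factor K is the inverse of [ubar^-1 x]_+, where x = x_word ws. *)
Lemma right_factor ws : nonzero ws -> reduced (neg ws) ->
  exists K, [/\ exists C, mx_inv K C, upper1 K,
    lower (swordV F (neg ws) * x_word ws * K) &
    forall ws1 ws2, ws = ws1 ++ ws2 -> upper1 (x_word ws2 * K * swordV F (neg ws2))].
Proof.
elim/last_ind: ws => [_ _|ws [[s i] t] IH].
  exists 1; rewrite /x_word /swordV !big_nil !mulr1; split; [|exact: unitri1|exact: rtrig1|].
    by exists 1; exact: mx_inv1.
  by case=> [|? ?] // [|? ?] // _; rewrite !big_nil !mulr1; exact: unitri1.
rewrite nonzero_rcons neg_rcons /= => /andP[nz nzw] red.
have ixi := x_elt_inv (s, i) nz.
case: s red ixi => red ixi; last first.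
(* Mirror image of [left_factor]: here a positive letter is upper unitriangular and is absorbed by
   [K]. *)
- have [K [[C iK] hK hQ hR]] := IH nzw red.
  have iK1 := mx_invM (mx_invC ixi) iK.
  have hK1 : upper1 (x_eltV (false, i) t * K).
    by apply: unitriM => //; [exact: up_rk_inj | exact: upper_x_elt_pos].
  exists (x_eltV (false, i) t * K); split => //.
  + by eexists; exact: iK1.
  + by rewrite x_word_rcons /= -!mulrA [x_elt _ _ * _]mulrA ixi.1 mul1r mulrA.
  + move=> ws1; case/lastP=> [_|ws2 b].
      by rewrite /swordV /x_word !big_nil mul1r mulr1.
    rewrite -rcons_cat => /rcons_inj[e <-]; rewrite x_word_rcons neg_rcons /=.
    rewrite -!mulrA [x_elt _ _ * _]mulrA ixi.1 mul1r mulrA.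
    exact: hR e.
have red' : reduced (neg ws) by apply: (@reduced_catl _ _ [:: i]); rewrite cats1.
have [K [[C iK] hK hQ hR]] := IH nzw red'.
set l := lo i; set h := hi i.
pose g := K l h - t^-1.
pose Y := phi i (mx22 1 0 g 1).
have iY : mx_inv Y (phi i (mx22 1 0 (- g) 1)).
  by split; rewrite phiM !(mulr0, mul0r, mulr1, mul1r, addr0, add0r, subrr, addNr) phi1.
set K1 := x_eltV (true, i) t * K * (sbar F i * Y).
have iK1 := mx_invM (mx_invM (mx_invC ixi) iK) (mx_invM (sbar_inv F i) iY).
have hK1 : upper1 K1.
  rewrite /K1 /x_eltV /Y /sbar phiM; apply: unitri_up_phi => //;
    rewrite ?phi_mulr_lo ?phi_mulr_hi ?phi_mull_lo ?phi_mull_hi -/l -/h;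
    rewrite (hK.1 h l) ?up_rk_lt ?lohi_lt // !hK.2;
    rewrite !(mulr0, mul0r, mulr1, mul1r, addr0, add0r, mulrN1, mulN1r, mulNr, mulrN, opprK).
  + by rewrite /g [- K l h + _]addrC addrA addrNK subrr.
  + by rewrite /g mulrBr opprB addrNK divrr // fld.
  + by [].
exists K1; split => //.
- by eexists; exact: iK1.
- rewrite x_word_rcons swordV_rcons /=.
  set Q := _ * _ * _ in hQ.
  have -> : sbarV F i * swordV F (neg ws) * (x_word ws * x_elt (true, i) t) * K1 =
      (sbarV F i * Q * sbar F i) * Y.
    rewrite /K1 /Q -!mulrA; do 3 congr (_ * _).
    by rewrite [x_elt _ _ * _]mulrA ixi.1 mul1r.
  (* As for [P0]: the conjugate of [Q] is the matrix of the last clause with [ws1] empty, which is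
     upper triangular, and the ascent sends [(h, l)] below its diagonal. *)
  have Q0 : Q h l = 0.
    apply: (@entry_conj _ _ (@up_rk n) (neg ws)) => //.
    + rewrite /Q !mulrA (sword_inv F _).1 mul1r.
      exact: (hR [::] ws erefl).1.
    + by rewrite up_rk_lt; apply: reduced_ascent.
  apply: rtrigM; last exact: lower_phi.
  apply: rtrig_lo_phi => //; rewrite phi_mulr_hi !phi_mull_lo -/l -/h.
  by rewrite Q0 !(mulr0, mul0r, mulr1, mul1r, addr0, add0r).
- move=> ws1; case/lastP=> [_|ws2 b].
    by rewrite /swordV /x_word !big_nil mul1r mulr1.
  rewrite -rcons_cat => /rcons_inj[e <-]; rewrite x_word_rcons neg_rcons /= swordV_rcons.
  have red2 : reduced (rcons (neg ws2) i).
    by apply: (@reduced_catr _ (neg ws1)); rewrite -rcons_cat -neg_cat -e.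
  have asc := reduced_ascent red2.
  (* The correction [Y] appears on the right as a conjugated elementary matrix whose off-diagonal
     entry [(l, h)] stays above the diagonal. *)
  have -> : x_word ws2 * x_elt (true, i) t * K1 * (sbarV F i * swordV F (neg ws2)) =
      x_word ws2 * K * swordV F (neg ws2) *
      (sword F (neg ws2) * (sbar F i * Y * sbarV F i) * swordV F (neg ws2)).
    rewrite /K1 -!mulrA; congr (_ * _).
    by rewrite [x_elt _ _ * _]mulrA [swordV _ _ * (sword _ _ * _)]mulrA ixi.1
       (sword_inv F _).2 !mul1r.
  apply: unitriM; [exact: up_rk_inj | exact: hR e|].
  apply: unitri_conj.
  + by apply: (@reduced_catl _ _ [:: i]); rewrite cats1.
  + by move=> p; rewrite sbar_conj_lower phi_unip_diag.
  + move=> p q; rewrite up_rk_lt => lt; rewrite sbar_conj_lower phiE.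
    case: (eqVneq p l) lt => [->|_]; last case: (eqVneq p h) => [->|_].
    * case: (eqVneq q l) => [->|_]; first by rewrite ltnn.
      by case: (eqVneq q h) => [->|] //; rewrite ltnNge ltnW.
    * case: (eqVneq q l) => // _.
      by case: (eqVneq q h) => [->|]; first by rewrite ltnn.
    * by case: (eqVneq p q) => [->|]; first by rewrite ltnn.
Qed.
End Factorization.

(** * The twist in terms of [B] and [K] *)

Section Twist.
Variables (F : unitRingType) (n : nat).
Hypothesis fld : GRing.field_axiom F.
Implicit Types (i : 'I_n) (t : F) (ws : seq (letter n * F)).
Notation lower := (rtrig (@lo_rk n)).
Notation upper1 := (unitri (@up_rk n)).

(** The hypotheses exhibit the two Gauss factorizations in the twist: its minus part is [A] and its
    plus part is [C]. Their positive inverses are [B] and [K] conjugated by [Jmx], and the inner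
    copies of [Jmx] cancel. *)
Lemma twistE ws (u v : 'S_n.+1) A B K C : nonzero ws ->
  reduced_word u (neg ws) -> reduced_word v (pos ws) ->
  mx_inv A B -> lower B -> upper1 (B * x_word ws * sword F (rev (pos ws))) ->
  mx_inv K C -> upper1 K -> lower (swordV F (neg ws) * x_word ws * K) ->
  twist u v (x_word ws) = Jmx F n * (B * x_word ws * K) * Jmx F n.
Proof.
move=> nz redu redv iA hB hP iK hK hQ.
have redvV : reduced_word (v^-1)%g (rev (pos ws)).
  have [<- _] := redv; rewrite -word_perm_rev; apply: reduced_rev.
  by split=> // js' e; apply: redv.2; rewrite e redv.1.
have [x' ix] := x_word_inv fld nz; set x := x_word ws in ix *.
have posE M M' : mx_inv M M' -> pos_inv M = Jmx F n * M' * Jmx F n.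
  by move=> iM; rewrite /pos_inv (inv_mxE iM).
rewrite /twist; have -> : minus_part (x *m wbar F (v^-1)%g) = A.
  rewrite (wbarE F redvV) /minus_part mulmxE.
  have [hA _] := rtrig_inv fld (@lo_rk_inj n) hB iA.2.
  have iP := mx_invM (mx_invM (mx_invC iA) ix) (sword_inv F (rev (pos ws))).
  rewrite (BU_factE fld iA iP hA hP) //.
  by rewrite !mulrA iA.1 mul1r.
have -> : plus_part (inv_mx (wbar F u) *m x) = C.
  rewrite (wbarE F redu) (inv_mxE (sword_inv F _)) /plus_part mulmxE.
  have hC := unitri_inv fld (@up_rk_inj n) hK iK.1.
  have iQ := mx_invM (mx_invM (mx_invC (sword_inv F (neg ws))) ix) iK.
  rewrite (BU_factE fld iQ (mx_invC iK) hQ hC) //.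
  by rewrite -mulrA iK.1 mulr1.
rewrite (posE _ _ iA) (posE _ _ (mx_invC iK)) (posE _ _ ix).
have iJx := mx_invM (mx_invM (Jmx_inv F n) (mx_invC ix)) (Jmx_inv F n).
have JK M : M * Jmx F n * Jmx F n = M by rewrite -mulrA Jmx_sqr mulr1.
by rewrite (inv_mxE iJx) !mulmxE !mulrA !JK.
Qed.

End Twist.

(** * Reading the parameters off diagonal entries *)

Theorem theorem4p11
  (F : unitRingType) (F_skew_field : GRing.field_axiom F)
  (n : nat) (u v : 'S_n.+1)
  (m : nat) (w : m.-tuple (letter n)) (hw : double_reduced_word u v w)
  (x : 'M[F]_n.+1) (hx : in_L u v x)
  (t : 'I_m -> F) (ht : forall k : 'I_m, t k != 0)
  (hfact : x = \prod_(k < m) x_elt (tnth w k) (t k)) :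
  let y := twist u v x in
  forall k : 'I_m,
  let i := (tnth w k).2 in
  if (tnth w k).1
  then
    [/\ Delta_defined (lo i) (v_lt w k) (u_gt w k) y /\
        Delta_defined (lo i) (v_lt w k) (u_ge w k) y,
        Delta_defined (hi i) (v_lt w k) (u_ge w k) y /\
        Delta_defined (hi i) (v_lt w k) (u_gt w k) y,
        t k = (Delta (lo i) (v_lt w k) (u_gt w k) y)^-1
              * Delta (lo i) (v_lt w k) (u_ge w k) y
      & t k = (Delta (hi i) (v_lt w k) (u_ge w k) y)^-1
              * Delta (hi i) (v_lt w k) (u_gt w k) y]
  else
    [/\ Delta_defined (lo i) (v_le w k) (u_gt w k) y /\
        Delta_defined (hi i) (v_lt w k) (u_gt w k) y,
        Delta_defined (lo i) (v_lt w k) (u_gt w k) y /\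
        Delta_defined (hi i) (v_le w k) (u_gt w k) y,
        t k = (Delta (lo i) (v_le w k) (u_gt w k) y)^-1
              * Delta (hi i) (v_lt w k) (u_gt w k) y
      & t k = (Delta (lo i) (v_lt w k) (u_gt w k) y)^-1
              * Delta (hi i) (v_le w k) (u_gt w k) y].
Proof.
set ws := [seq (tnth w k, t k) | k <- enum 'I_m].
have wsE : unzip1 ws = w by rewrite /unzip1 /ws -map_comp map_tnth_enum.
have nz : nonzero ws by rewrite /nonzero /ws all_map; apply/allP=> k _; exact: ht.
have {hx} xE : x = x_word ws by rewrite hfact /x_word /ws big_map enumT [index_enum _]unlock.
have vE j : v_lt w j = word_perm (pos (take j ws)).
  by rewrite /v_lt /pos -wsE /unzip1 map_take.
have uE j : u_ge w j = word_perm (rev (neg (drop j ws))).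
  by rewrite /u_ge /neg -wsE /unzip1 map_drop.
have [redu redv] := hw.
have {}redu : reduced_word u (neg ws) by rewrite /neg wsE.
have {}redv : reduced_word v (pos ws) by rewrite /pos wsE.
have redn : reduced (neg ws) by have [e _] := redu; rewrite /reduced e.
have redp : reduced (pos ws) by have [e _] := redv; rewrite /reduced e.
have [B [[A iA] hB hP hN]] := left_factor F_skew_field nz redp.
have [K [[C iK] hK hQ hR]] := right_factor F_skew_field nz redn.
have twE := twistE F_skew_field nz redu redv iA hB hP iK hK hQ.
move=> y k i; rewrite {}/y xE twE; set y := _ * Jmx F n.
pose N j := sword F (rev (pos (take j ws))) * B * x_word (take j ws).
have nz_take j : nonzero (take j ws).
  by move: nz; rewrite -{1}(cat_take_drop j ws) /nonzero all_cat => /andP[].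
have nz_drop j : nonzero (drop j ws).
  by move: nz; rewrite -{1}(cat_take_drop j ws) /nonzero all_cat => /andP[].
have lowN j : rtrig (@lo_rk n) (N j) by apply: (hN _ (drop j ws)); rewrite cat_take_drop.
have invN j : exists N', mx_inv (N j) N'.
  have [M iM] := x_word_inv F_skew_field (nz_take j).
  by eexists; exact: mx_invM (mx_invM (sword_inv F _) (mx_invC iA)) iM.
have nzN j p : N j p p != 0.
  by have [N' iN] := invN j; have [_] := rtrig_inv F_skew_field (@lo_rk_inj n) (lowN j) iN.1.
have H j p : Delta_defined p (v_lt w j) (u_ge w j) y /\
    Delta p (v_lt w j) (u_ge w j) y = N j p p.
  have [N' iN] := invN j.
  have [M iM] := x_word_inv F_skew_field (nz_drop j).
  have iR := mx_invM (mx_invM iM iK) (mx_invC (sword_inv F (neg (drop j ws)))).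
  set R := _ * swordV _ _ in iR.
  have hRj : unitri (@up_rk n) R by apply: (hR (take j ws)); rewrite cat_take_drop.
  have iJ := Jmx_inv F n.
  rewrite -[N j p p]Jmx_conj_diag.
  apply: (@DeltaE _ _ F_skew_field _ _ _ _ _ _ _ _
    (mx_invM (mx_invM iJ iN) iJ) (mx_invM (mx_invM iJ iR) iJ)).
  - exact: Jmx_conj_rtrig.
  - exact: Jmx_conj_unitri.
  have redpj : reduced (pos (take j ws)).
    by apply: (@reduced_catl _ _ (pos (drop j ws))); rewrite -pos_cat cat_take_drop.
  have rednj : reduced (neg (drop j ws)).
    by apply: (@reduced_catr _ (neg (take j ws))); rewrite -neg_cat cat_take_drop.
  rewrite vE uE -!swordE //; last exact: reduced_rev.
  (* On the left, moving [Jmx] past the lift produces the last factor of [R]; on the right, it turns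
     the first factor of [N j] into the inverse of the lift in front. *)
  rewrite /y /R /N -{1}(cat_take_drop j ws) x_wordM -!mulrA Jmx_sword revK.
  have JK M' : Jmx F n * (Jmx F n * M') = M' by rewrite mulrA Jmx_sqr mul1r.
  rewrite JK; set Z := B * _.
  rewrite [Jmx F n * (sword F (rev (pos _)) * _)]mulrA Jmx_sword revK.
  by rewrite -!mulrA [sword F _ * (swordV F _ * _)]mulrA (sword_inv F _).1 mul1r.
have ltk : (k < size ws)%N by rewrite /ws size_map size_enum_ord.
have nthk : nth (tnth w k, t k) ws k = (tnth w k, t k).
  by rewrite /ws (nth_map k) ?size_enum_ord // nth_ord_enum.
have tk := take_nth (tnth w k, t k) ltk; rewrite nthk in tk.
have dk := drop_nth (tnth w k, t k) ltk; rewrite nthk in dk.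
rewrite /u_gt /v_le; set a := N k (lo i) (lo i); set d := N k (hi i) (hi i).
have nza : a \is a GRing.unit := F_skew_field _ (nzN k (lo i)).
have nzd : d \is a GRing.unit := F_skew_field _ (nzN k (hi i)).
have lo_hi j : N j (lo i) (hi i) = 0 by apply: lowN; apply: lohi_lt.
have nzt := F_skew_field _ (ht k).
case: ifPn => sk.
(* For a negative letter [v_lt] does not change, and the diagonal entries [a], [d] become
   [a * (t k)^-1] and [d * t k]. *)
- have ek : tnth w k = (true, i) by rewrite [LHS]surjective_pairing sk.
  have vk : v_lt w k.+1 = v_lt w k.
    by rewrite !vE tk /pos /unzip1 map_rcons /pos_part filter_rcons ek.
  have Nk : N k.+1 = N k * x_elt (true, i) (t k).
    rewrite /N tk x_word_rcons ek /= mulrA.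
    by rewrite /pos /unzip1 map_rcons /pos_part filter_rcons.
  have [D1 E1] := H k (lo i); have [D2 E2] := H k (hi i).
  have [D3 E3] := H k.+1 (lo i); have [D4 E4] := H k.+1 (hi i).
  rewrite vk in D3 E3 D4 E4; rewrite E1 E2 E3 E4 Nk /x_elt /=; split=> //.
  + rewrite phi_mulr_lo lo_hi mul0r addr0 -/a invrM ?unitrV // invrK -mulrA.
    by rewrite mulVr // mulr1.
  + by rewrite phi_mulr_hi mulr0 add0r -/d mulKr.
- have ek : tnth w k = (false, i) by rewrite [LHS]surjective_pairing (negPf sk).
  have uk : u_ge w k.+1 = u_ge w k.
    by rewrite !uE dk /neg /unzip1 /neg_part /= ek.
  have Nk : N k.+1 = sbar F i * N k * x_elt (false, i) (t k).
    rewrite /N tk x_word_rcons ek /= /pos /unzip1 map_rcons /pos_part filter_rcons /=.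
    by rewrite map_rcons rev_rcons sword_cons !mulrA.
  have [D1 E1] := H k (lo i); have [D2 E2] := H k (hi i).
  have [D3 E3] := H k.+1 (lo i); have [D4 E4] := H k.+1 (hi i).
  (* For a positive letter the swap brings this entry onto the diagonal. It is determined by the
     vanishing of the [(lo i, hi i)] entry of [N k.+1]; the new diagonal entries are then
     [d * (t k)^-1] and [a * t k]. *)
  have e : N k (hi i) (lo i) = - (d * (t k)^-1).
    have := lo_hi k.+1; rewrite Nk /x_elt /sbar /= phi_mulr_hi !phi_mull_lo.
    rewrite !mul0r !add0r !mulN1r mulr1 mulNr -opprD => /eqP.
    by rewrite oppr_eq0 addr_eq0 => /eqP /(canRL (mulrK nzt)); rewrite mulNr.
  rewrite uk in D3 E3 D4 E4 *; rewrite E1 E2 E3 E4 Nk /x_elt /sbar /=; split=> //.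
  + rewrite phi_mulr_lo !phi_mull_lo mul0r add0r mulN1r mulr1 mulr0 addr0 e opprK -/d.
    by rewrite invrM ?unitrV // invrK -mulrA mulVr // mulr1.
  + rewrite phi_mulr_hi !phi_mull_hi !mul0r !addr0 !mul1r lo_hi mul0r addr0 -/a.
    by rewrite mulKr.
Qed.
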